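(* Let $\mathbb H=(A,\prec,\mathcal C)$ be an sp-algebra and $\mathbb K=(A,\prec,\mathcal D)$ an sdp-algebra. Write $\overline{\mathcal C}$, $\overline{\mathcal D}$ for the complements of $\mathcal C,\mathcal D$ in $A\times A$. In $A^\delta$ let $\Diamond a=\bigwedge\{b\mid a\prec b\}$, $\blacksquare a=\bigvee\{b\mid b\prec a\}$, $\rhd a=\bigvee\{b\mid a\,\overline{\mathcal C}\,b\}$, $\blacktriangleright a=\bigvee\{b\mid b\,\overline{\mathcal C}\,a\}$, $\lhd a=\bigwedge\{b\mid a\,\overline{\mathcal D}\,b\}$ (with $a,b$ in $A$), $\Diamond$ and $\rhd$ being extended to $A^\delta$ as $\Diamond^\sigma$ and $\rhd^\pi$ (superscripts omitted). Inequalities are in $A^\delta$ with $a,b,c$ ranging over $A$. 1. $\mathbb H$ satisfies (INC) iff $\blacksquare a\le\blacktriangleright a$ for all $a$. 2. If $A$ is a meet-semilattice, then $\mathbb H$ satisfies (CT)$^\rhd$ iff $\rhd(a\wedge\Diamond a)\le\rhd a$ for all $a$. 3. If $A$ (for $\mathbb H$) is a Heyting algebra, then (i) $\mathbb H$ satisfies (CS2) iff $\Diamond a\to\rhd a\le\rhd a$ for all $a$; (ii) $\mathbb H$ satisfies (CT)$^\downarrow$ iff $\blacksquare b\wedge\blacktriangleright(b\wedge c)\le b\to\blacktriangleright c$ for all $b,c$. 4. If $A$ (for $\mathbb H$) is a co-Heyting algebra, then $\mathbb H$ satisfies (CS1) iff $\Diamond a\le\Diamond a\setminus\rhd a$ for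 all $a$. 5. If $A$ (for $\mathbb K$) is a co-Heyting algebra, then $\mathbb K$ satisfies (CT)$^\lhd$ iff $\lhd a\le\Diamond(\lhd a\setminus a)$ for all $a$.
   Context: Canonical extension. For a poset $A$, $A^\delta$ is a complete lattice containing $A$ as a subposet. $k\in A^\delta$ is closed ($k\in K(A^\delta)$) if $k=\bigwedge F$ for some nonempty down-directed $F\subseteq A$; $o$ is open ($o\in O(A^\delta)$) if $o=\bigvee I$ for some nonempty up-directed $I\subseteq A$. Denseness: every element of $A^\delta$ is a join of closed elements and a meet of open elements. Compactness: if $F\subseteq A$ is nonempty down-directed, $I\subseteq A$ nonempty up-directed and $\bigwedge F\le\bigvee I$, then $a\le b$ for some $a\in F$, $b\in I$. $A^\delta$ exists and is unique up to isomorphism fixing $A$. Throughout $A$ is a bounded lattice. $(A,\prec)$ is a subordination algebra if $\bot\prec\bot$; $\top\prec\top$; $a\le b\prec x\Rightarrow a\prec x$; $b\prec x\le y\Rightarrow b\prec y$; $a\prec x\ \&\ a\prec y\Rightarrow a\prec x\wedge y$; $a\prec x\ \&\ b\prec x\Rightarrow a\vee b\prec x$. $(A,\mathcal C)$ is a precontact algebra if $\bot\,\overline{\mathcal C}\,\top$; $\top\,\overline{\mathcal C}\,\bot$; $b\,\overline{\mathcal C}\,c\ \&\ a\le b\Rightarrow a\,\overline{\mathcal C}\,c$; $a\,\overline{\mathcal C}\,c\ \&\ b\le c\Rightarrow a\,\overline{\mathcal C}\,b$; $a\,\overline{\mathcal C}\,b\ \&\ a\,\overline{\mathcal C}\,c\Rightarrow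 a\,\overline{\mathcal C}\,(b\vee c)$; $a\,\overline{\mathcal C}\,c\ \&\ b\,\overline{\mathcal C}\,c\Rightarrow(a\vee b)\,\overline{\mathcal C}\,c$. $(A,\mathcal D)$ is a dual precontact algebra if $\top\,\overline{\mathcal D}\,\bot$; $\bot\,\overline{\mathcal D}\,\top$; $a\le b\ \&\ a\,\overline{\mathcal D}\,c\Rightarrow b\,\overline{\mathcal D}\,c$; $a\,\overline{\mathcal D}\,c\ \&\ c\le b\Rightarrow a\,\overline{\mathcal D}\,b$; $a\,\overline{\mathcal D}\,b\ \&\ a\,\overline{\mathcal D}\,c\Rightarrow a\,\overline{\mathcal D}\,(b\wedge c)$; $a\,\overline{\mathcal D}\,c\ \&\ b\,\overline{\mathcal D}\,c\Rightarrow(a\wedge b)\,\overline{\mathcal D}\,c$. An sp-algebra is $(A,\prec,\mathcal C)$ with $(A,\prec)$ a subordination algebra and $(A,\mathcal C)$ a precontact algebra; an sdp-algebra is $(A,\prec,\mathcal D)$ with $(A,\prec)$ a subordination algebra and $(A,\mathcal D)$ a dual precontact algebra. Extensions: $\Diamond^\sigma k=\bigwedge\{\Diamond a\mid a\in A,k\le a\}$ for $k$ closed, $\Diamond^\sigma u=\bigvee\{\Diamond^\sigma k\mid k\in K(A^\delta),k\le u\}$; $\rhd^\pi k=\bigvee\{\rhd a\mid a\in A,k\le a\}$ for $k$ closed, $\rhd^\pi u=\bigwedge\{\rhd^\pi k\mid k\in K(A^\delta),k\le u\}$. A co-Heyting algebra is a (bounded) distributive lattice with a binary operation $\setminus$ such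 that $a\setminus b\le c$ iff $a\le c\vee b$. In $A^\delta$: in the Heyting case $u\to v$ is the largest $w$ with $u\wedge w\le v$; in the co-Heyting case $u\setminus v$ is the least $w$ with $u\le w\vee v$. Conditions (free variables universally quantified): (INC) $a\prec b\Rightarrow a\,\overline{\mathcal C}\,b$. (CT)$^\rhd$ $a\prec b\ \&\ (a\wedge b)\,\overline{\mathcal C}\,c\Rightarrow a\,\overline{\mathcal C}\,c$. (CS1) $a\prec x\vee y\ \&\ a\,\overline{\mathcal C}\,x\Rightarrow a\prec y$. (CS2) $a\,\overline{\mathcal C}\,(x\wedge y)\ \&\ a\prec x\Rightarrow a\,\overline{\mathcal C}\,y$. (CT)$^\downarrow$ $a\prec b\ \&\ a\,\overline{\mathcal C}\,(b\wedge c)\Rightarrow(a\wedge b)\,\overline{\mathcal C}\,c$. (CT)$^\lhd$ $a\,\overline{\mathcal D}\,b\ \&\ (b\setminus a)\prec c\Rightarrow a\,\overline{\mathcal D}\,c$. *)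

(* Defs.v *)
From mathcomp Require Import all_boot all_order.
From mathcomp Require Import boolp classical_sets.

Set Implicit Arguments.
Unset Strict Implicit.
Unset Printing Implicit Defensive.

Import Order.TTheory.
Local Open Scope classical_set_scope.
Local Open Scope order_scope.

(* [supremum x0 S] is [x0] on the empty set, and is only meaningful when [S]
   has a least upper bound; [x0 := \bot] is thus the right default (dually for
   [infimum]), and [complete_lattice] makes both total. *)
Definition bigjoin d (D : tbLatticeType d) (S : set D) : D := supremum \bot S.
Definition bigmeet d (D : tbLatticeType d) (S : set D) : D := infimum \top S.

Definition complete_lattice d (D : tbLatticeType d) : Prop :=
  forall S : set D, supremums S !=set0 /\ infimums S !=set0.

Section CanonicalExtension.
Context (d d' : Order.disp_t) (A : porderType d) (D : tbLatticeType d').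
Implicit Types (e f : A -> D) (F I : set A) (k o u : D).

Definition down_directed F : Prop :=
  forall a b, F a -> F b -> exists2 c, F c & c <= a /\ c <= b.

Definition up_directed I : Prop :=
  forall a b, I a -> I b -> exists2 c, I c & a <= c /\ b <= c.

Definition closed_elt e k : Prop :=
  exists F, [/\ F !=set0, down_directed F & k = bigmeet (e @` F)].

Definition open_elt e o : Prop :=
  exists I, [/\ I !=set0, up_directed I & o = bigjoin (e @` I)].

(* [D], together with the order embedding [e], is a canonical extension of
   [A]. *)
Record canonical_extension e : Prop := CanonicalExtension {
  canext_complete : complete_lattice D;
  canext_embed : {mono e : a b / a <= b};
  canext_dense_closed : forall u,
    exists2 K : set D, (forall k, K k -> closed_elt e k) & u = bigjoin K;
  canext_dense_open : forall u,
    exists2 O : set D, (forall o, O o -> open_elt e o) & u = bigmeet O;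
  canext_compact : forall F I,
    F !=set0 -> down_directed F -> I !=set0 -> up_directed I ->
    bigmeet (e @` F) <= bigjoin (e @` I) ->
    exists a b, [/\ F a, I b & a <= b]
}.

(* The sigma-extension of a monotone map into [D], given first on closed
   elements. *)
Definition sigma_closed e f k : D := bigmeet [set f a | a in [set a | k <= e a]].
Definition sigma_ext e f u : D :=
  bigjoin [set sigma_closed e f k | k in [set k | closed_elt e k /\ k <= u]].

(* The pi-extension of an antitone map into [D], given first on closed
   elements. *)
Definition pi_closed e f k : D := bigjoin [set f a | a in [set a | k <= e a]].
Definition pi_ext e f u : D :=
  bigmeet [set pi_closed e f k | k in [set k | closed_elt e k /\ k <= u]].

End CanonicalExtension.

(* The largest [w] with [u `&` w <= v], resp. the least [w] with
   [u <= w `|` v]; the value is junk when there is none, but both exist in the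
   canonical extension of a Heyting, resp. co-Heyting, algebra. *)
Definition largest_of d (D : tbLatticeType d) (S : set D) : D :=
  xget \bot [set w | S w /\ ubound S w].
Definition least_of d (D : tbLatticeType d) (S : set D) : D :=
  xget \top [set w | S w /\ lbound S w].

Definition dimp d (D : tbLatticeType d) (u v : D) : D :=
  largest_of [set w | u `&` w <= v].
Definition dsub d (D : tbLatticeType d) (u v : D) : D :=
  least_of [set w | u <= w `|` v].

Section Algebras.
Context (d : Order.disp_t) (A : tbLatticeType d).
Implicit Types (prec C Dp : A -> A -> Prop) (imp sub : A -> A -> A).

Record subordination_algebra prec : Prop := SubordinationAlgebra {
  subord_bot : prec \bot \bot;
  subord_top : prec \top \top;
  subord_SI : forall a b x, a <= b -> prec b x -> prec a x;
  subord_WO : forall b x y, prec b x -> x <= y -> prec b y;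
  subord_AND : forall a x y, prec a x -> prec a y -> prec a (x `&` y);
  subord_OR : forall a b x, prec a x -> prec b x -> prec (a `|` b) x
}.

Record precontact_algebra C : Prop := PrecontactAlgebra {
  precontact_bt : ~ C \bot \top;
  precontact_tb : ~ C \top \bot;
  precontact_l : forall a b c, ~ C b c -> a <= b -> ~ C a c;
  precontact_r : forall a b c, ~ C a c -> b <= c -> ~ C a b;
  precontact_joinr : forall a b c, ~ C a b -> ~ C a c -> ~ C a (b `|` c);
  precontact_joinl : forall a b c, ~ C a c -> ~ C b c -> ~ C (a `|` b) c
}.

Record dual_precontact_algebra Dp : Prop := DualPrecontactAlgebra {
  dprecontact_tb : ~ Dp \top \bot;
  dprecontact_bt : ~ Dp \bot \top;
  dprecontact_l : forall a b c, a <= b -> ~ Dp a c -> ~ Dp b c;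
  dprecontact_r : forall a b c, ~ Dp a c -> c <= b -> ~ Dp a b;
  dprecontact_meetr : forall a b c, ~ Dp a b -> ~ Dp a c -> ~ Dp a (b `&` c);
  dprecontact_meetl : forall a b c, ~ Dp a c -> ~ Dp b c -> ~ Dp (a `&` b) c
}.

Definition sp_algebra prec C : Prop :=
  subordination_algebra prec /\ precontact_algebra C.

Definition sdp_algebra prec Dp : Prop :=
  subordination_algebra prec /\ dual_precontact_algebra Dp.

Definition distributive_lattice : Prop :=
  left_distributive (@Order.meet _ A) (@Order.join _ A).

Definition heyting_algebra imp : Prop :=
  distributive_lattice /\ forall a b c, (a `&` c <= b) = (c <= imp a b).

Definition coheyting_algebra sub : Prop :=
  distributive_lattice /\ forall a b c, (sub a b <= c) = (a <= c `|` b).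

Definition INC prec C : Prop := forall a b, prec a b -> ~ C a b.
Definition CT_rhd prec C : Prop :=
  forall a b c, prec a b -> ~ C (a `&` b) c -> ~ C a c.
Definition CS1 prec C : Prop :=
  forall a x y, prec a (x `|` y) -> ~ C a x -> prec a y.
Definition CS2 prec C : Prop :=
  forall a x y, ~ C a (x `&` y) -> prec a x -> ~ C a y.
Definition CT_down prec C : Prop :=
  forall a b c, prec a b -> ~ C a (b `&` c) -> ~ C (a `&` b) c.
Definition CT_lhd prec Dp sub : Prop :=
  forall a b c, ~ Dp a b -> prec (sub b a) c -> ~ Dp a c.

End Algebras.

Section Operators.
Context (d d' : Order.disp_t) (A : tbLatticeType d) (D : tbLatticeType d').
Context (e : A -> D).
Implicit Types (prec C Dp : A -> A -> Prop).

Definition dia prec (a : A) : D := bigmeet (e @` [set b | prec a b]).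
Definition bbox prec (a : A) : D := bigjoin (e @` [set b | prec b a]).
Definition rhd C (a : A) : D := bigjoin (e @` [set b | ~ C a b]).
Definition brhd C (a : A) : D := bigjoin (e @` [set b | ~ C b a]).
Definition lhd Dp (a : A) : D := bigmeet (e @` [set b | ~ Dp a b]).

Definition dia_ext prec : D -> D := sigma_ext e (dia prec).
Definition rhd_ext C : D -> D := pi_ext e (rhd C).

End Operators.

(* Main.v *)
(* By compactness, inequalities of the form "closed <= open" in the canonical
   extension reduce to inequalities between members of the directed sets that
   present both sides; so [e b <= rhd e C a] means [~ C a b],
   [dia e prec a <= e b] means [prec a b], and likewise for the other operators.
   Every condition is then read off by testing on closed (or open) elements.  The
   direction from an inequality back to a condition needs the residuals of the
   extension to exist, which is shown only for [k -> o] and [k \ o] with [k]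
   closed and [o] open: [k -> o] is the directed join of the [imp x y] with
   [k <= e x] and [e y <= o]. *)
Require Import Defs.
From mathcomp Require Import all_boot all_order.
From mathcomp Require Import boolp classical_sets.

Set Implicit Arguments.
Unset Strict Implicit.
Unset Printing Implicit Defensive.

Import Order.TTheory.
Local Open Scope classical_set_scope.
Local Open Scope order_scope.

(** * Arbitrary joins and meets in a complete lattice *)

Section CompleteLattice.
Context (d : Order.disp_t) (D : tbLatticeType d).
Hypothesis cD : complete_lattice D.

Lemma bigjoin_lub (S : set D) : isLub S (bigjoin S).
Proof.
rewrite /bigjoin /supremum; case: eqP => [->|_].
  by split=> [x []|b _]; exact: le0x.
have [[x Sx] _] := cD S.
by case: xgetP => [y _ [yub ylb]|/(_ x Sx)//]; split.
Qed.

Lemma le_bigjoin (S : set D) x : S x -> x <= bigjoin S.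
Proof. by case: (bigjoin_lub S) => + _; apply. Qed.

Lemma bigjoin_le (S : set D) y : (forall x, S x -> x <= y) -> bigjoin S <= y.
Proof. by case: (bigjoin_lub S) => _; apply. Qed.

End CompleteLattice.

Section CompleteLatticeDual.
Context (d : Order.disp_t) (D : tbLatticeType d).
Hypothesis cD : complete_lattice D.

Lemma complete_lattice_dual : @complete_lattice _ D^d.
Proof. by move=> S; case: (cD S). Qed.

Lemma bigmeet_le (S : set D) x : S x -> bigmeet S <= x.
Proof. exact: (@le_bigjoin _ D^d complete_lattice_dual S x). Qed.

Lemma le_bigmeet (S : set D) y : (forall x, S x -> y <= x) -> y <= bigmeet S.
Proof. exact: (@bigjoin_le _ D^d complete_lattice_dual S y). Qed.

End CompleteLatticeDual.

Definition down_base d (A : porderType d) (F : set A) : Prop :=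
  F !=set0 /\ down_directed F.
Definition up_base d (A : porderType d) (I : set A) : Prop :=
  I !=set0 /\ up_directed I.

(** Reversing both orders exchanges closed with open elements and swaps the roles of [F] and [I] in
    compactness. Facts about open elements, joins and [sub] can thus be read off from those about
    closed elements, meets and [imp]. *)
Lemma canonical_extension_dual d d' (A : porderType d) (D : tbLatticeType d')
    (e : A -> D) :
  canonical_extension e -> @canonical_extension _ _ A^d D^d e.
Proof.
case=> cD emono dc dop cp; split=> //; first exact: complete_lattice_dual.
- by move=> x y; exact: emono.
- move=> F I F0 dF I0 dI le_FI.
  by have [a [b [? ? ?]]] := cp I F I0 dI F0 dF le_FI; exists b, a.
Qed.

(** * Denseness and compactness, tested on closed elements *)

Section CanonicalExtension.
Context (d d' : Order.disp_t) (A : tbLatticeType d) (D : tbLatticeType d').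
Context (e : A -> D).
Hypothesis canD : canonical_extension e.
Implicit Types (F G I : set A) (a b : A) (k u v w : D).

Let cD := canext_complete canD.

Lemma canext_le a b : (e a <= e b) = (a <= b).
Proof. exact: canext_embed. Qed.

Lemma bigmeet_img_le F a : F a -> bigmeet (e @` F) <= e a.
Proof. by move=> Fa; apply: (bigmeet_le cD); exists a. Qed.

Lemma le_bigjoin_img I a : I a -> e a <= bigjoin (e @` I).
Proof. by move=> Ia; apply: (le_bigjoin cD); exists a. Qed.

Lemma le_bigmeet_img F u : (forall a, F a -> u <= e a) -> u <= bigmeet (e @` F).
Proof. by move=> le_uF; apply: (le_bigmeet cD) => _ [a Fa <-]; exact: le_uF. Qed.

Lemma bigjoin_img_le I u : (forall a, I a -> e a <= u) -> bigjoin (e @` I) <= u.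
Proof. by move=> le_Iu; apply: (bigjoin_le cD) => _ [a Ia <-]; exact: le_Iu. Qed.

Lemma closed_bigmeet F : down_base F -> closed_elt e (bigmeet (e @` F)).
Proof. by case=> F0 dF; exists F. Qed.

(** Denseness writes [u] as a join of closed elements, so it suffices to bound each of these by
    [v]. *)
Lemma closed_le u v :
  (forall F, down_base F -> bigmeet (e @` F) <= u -> bigmeet (e @` F) <= v) ->
  u <= v.
Proof.
move=> le_uv; have [K clK uE] := canext_dense_closed canD u.
rewrite {1}uE; apply: (bigjoin_le cD) => k Kk.
have [F [F0 dF kE]] := clK k Kk.
by rewrite kE; apply: le_uv => //; rewrite -kE uE; exact: (le_bigjoin cD).
Qed.

Lemma canext_compact_base F I : down_base F -> up_base I ->
  bigmeet (e @` F) <= bigjoin (e @` I) ->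
  exists a b, [/\ F a, I b & a <= b].
Proof. by move=> [F0 dF] [I0 dI]; exact: canext_compact. Qed.

(** Through singletons an element of [A] counts as both closed and open, which gives the one-sided
    forms of compactness. *)
Lemma down_base1 a : down_base [set a].
Proof. by split; [exists a | move=> x y /= -> ->; exists a]. Qed.

Lemma up_base1 a : up_base [set a].
Proof. by split; [exists a | move=> x y /= -> ->; exists a]. Qed.

Lemma bigmeet_img1 a : bigmeet (e @` [set a]) = e a.
Proof. by rewrite image_set1 /bigmeet; exact: (@supremum1 _ D^d). Qed.

Lemma bigjoin_img1 a : bigjoin (e @` [set a]) = e a.
Proof. by rewrite image_set1 /bigjoin supremum1. Qed.

Lemma bigmeet_le_canext F a : down_base F -> bigmeet (e @` F) <= e a ->
  exists2 f, F f & f <= a.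
Proof.
move=> bF; rewrite -bigjoin_img1 => /(canext_compact_base bF (up_base1 a)).
by case=> f [_ [Ff -> lefa]]; exists f.
Qed.

Lemma canext_le_bigjoin I a : up_base I -> e a <= bigjoin (e @` I) ->
  exists2 i, I i & a <= i.
Proof.
move=> bI; rewrite -bigmeet_img1 => /(canext_compact_base (down_base1 a) bI).
by case=> _ [i [-> Ii leai]]; exists i.
Qed.

(** A closed element below [e a] and [e b] has, by compactness, members of its family below [a] and
    below [b]; directedness gives one member below both, hence below their meet in [A]. *)
Lemma canext_meet a b : e (a `&` b) = e a `&` e b.
Proof.
apply/le_anti/andP; split; first by rewrite lexI !canext_le leIl leIr.
apply: closed_le => F bF; rewrite lexI => /andP[].
move=> /(bigmeet_le_canext bF)[f Ff lefa] /(bigmeet_le_canext bF)[g Fg legb].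
have [_ dF] := bF; have [h Fh [lehf lehg]] := dF f g Ff Fg.
apply: le_trans (bigmeet_img_le Fh) _; rewrite canext_le lexI.
by rewrite (le_trans lehf) ?(le_trans lehg).
Qed.

Definition meets F G : set A := [set c | exists a b, [/\ F a, G b & c = a `&` b]].

Lemma down_base_meets F G : down_base F -> down_base G -> down_base (meets F G).
Proof.
move=> [[f Ff] dF] [[g Gg] dG]; split; first by exists (f `&` g), f, g.
move=> _ _ [a [b [Fa Gb ->]]] [a' [b' [Fa' Gb' ->]]].
have [a0 Fa0 [lea lea']] := dF _ _ Fa Fa'.
have [b0 Gb0 [leb leb']] := dG _ _ Gb Gb'.
by exists (a0 `&` b0); [exists a0, b0 | split; exact: leI2].
Qed.

Lemma bigmeet_meets F G : down_base F -> down_base G ->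
  bigmeet (e @` meets F G) = bigmeet (e @` F) `&` bigmeet (e @` G).
Proof.
move=> [[f Ff] _] [[g Gg] _]; apply/le_anti/andP; split.
  rewrite lexI; apply/andP; split; apply: le_bigmeet_img => a Pa.
  - have Pag : meets F G (a `&` g) by exists a, g.
    by apply: le_trans (bigmeet_img_le Pag) _; rewrite canext_le leIl.
  - have Pfa : meets F G (f `&` a) by exists f, a.
    by apply: le_trans (bigmeet_img_le Pfa) _; rewrite canext_le leIr.
apply: le_bigmeet_img => _ [a [b [Fa Gb ->]]].
by rewrite canext_meet leI2// bigmeet_img_le.
Qed.

Lemma canext_compact_meet F G I : down_base F -> down_base G -> up_base I ->
  bigmeet (e @` F) `&` bigmeet (e @` G) <= bigjoin (e @` I) ->
  exists a b c, [/\ F a, G b, I c & a `&` b <= c].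
Proof.
move=> bF bG bI; rewrite -bigmeet_meets//.
move=> /(canext_compact_base (down_base_meets bF bG) bI).
by move=> [_ [c [[a [b [Fa Gb ->]]] Ic le_abc]]]; exists a, b, c.
Qed.

(* In the junk case [dimp u v] is [\bot], so no existence is required here. *)
Lemma meet_dimp_le u v : u `&` dimp u v <= v.
Proof.
rewrite /dimp /largest_of; case: xgetP => [w _ []//|_].
exact: le_trans (leIr _ _) (le0x _).
Qed.

(** * Implication from a closed to an open element *)

Section Residuation.
Variable imp : A -> A -> A.
Hypothesis impP : forall a b c, (a `&` c <= b) = (c <= imp a b).
Variables F I : set A.
Hypotheses (bF : down_base F) (bI : up_base I).

Definition imps : set A := [set c | exists x y, [/\ F x, I y & c = imp x y]].

Lemma up_base_imps : up_base imps.
Proof.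
have [[x0 Fx0] dF] := bF; have [[y0 Iy0] dI] := bI.
split; first by exists (imp x0 y0), x0, y0.
move=> _ _ [x [y [Fx Iy ->]]] [x' [y' [Fx' Iy' ->]]].
have [x1 Fx1 [lex lex']] := dF _ _ Fx Fx'.
have [y1 Iy1 [ley ley']] := dI _ _ Iy Iy'.
exists (imp x1 y1); first by exists x1, y1.
(* Implication is antitone on the left and monotone on the right, so a lower bound [x1] and an upper
   bound [y1] give an upper bound of the two implications. *)
have imp_mono x2 y2 : x1 <= x2 -> y2 <= y1 -> imp x2 y2 <= imp x1 y1.
  move=> lex12 ley21; rewrite -impP; apply: le_trans ley21.
  by rewrite (le_trans (leI2 lex12 (lexx _)))// impP.
by split; exact: imp_mono.
Qed.

(** Both directions are tested on the closed elements below the left-hand side. Compactness brings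
    each down to [A], where [impP] exchanges [g <= imp x y] and the bound by [y] on the meet of [x]
    and [g]. *)
Lemma le_bigjoin_imps w :
  (w <= bigjoin (e @` imps)) =
    (bigmeet (e @` F) `&` w <= bigjoin (e @` I)).
Proof.
apply/idP/idP => le_w; apply: closed_le => G bG le_G.
- move: le_G; rewrite lexI => /andP[le_GF le_Gw].
  have [g [_ [Gg [x [y [Fx Iy ->]]]]]] :=
    canext_compact_base bG up_base_imps (le_trans le_Gw le_w).
  rewrite -impP => le_xgy.
  apply: le_trans (le_bigjoin_img Iy); move: le_xgy.
  rewrite -canext_le canext_meet; apply: le_trans.
  by rewrite lexI (bigmeet_img_le Gg) (le_trans le_GF (bigmeet_img_le Fx)).
- have [x [g [y [Fx Gg Iy le_xgy]]]] :=
    canext_compact_meet bF bG bI (le_trans (leI2 (lexx _) le_G) le_w).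
  apply: le_trans (bigmeet_img_le Gg) _.
  apply: (@le_trans _ _ (e (imp x y))); first by rewrite canext_le -impP.
  by apply: le_bigjoin_img; exists x, y.
Qed.

Lemma dimpE :
  dimp (bigmeet (e @` F)) (bigjoin (e @` I)) = bigjoin (e @` imps).
Proof.
apply/le_anti/andP; split; first by rewrite le_bigjoin_imps meet_dimp_le.
(* The junk case cannot occur, since the join of [imps] is itself a largest element of the set. *)
rewrite /dimp /largest_of; case: xgetP => [w _ [_ w_max]|no_max].
  by apply: w_max; rewrite /= -le_bigjoin_imps.
case: (no_max (bigjoin (e @` imps))); split; first by rewrite /= -le_bigjoin_imps.
by move=> w; rewrite /= -le_bigjoin_imps.
Qed.

Lemma le_dimp w :
  (w <= dimp (bigmeet (e @` F)) (bigjoin (e @` I))) =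
    (bigmeet (e @` F) `&` w <= bigjoin (e @` I)).
Proof. by rewrite dimpE le_bigjoin_imps. Qed.

End Residuation.

(** The set [[set a | k <= e a]] shrinks as [k] grows, so [sigma_closed] is monotone in [k] and the
    outer join is attained at the largest index, the closed element itself. Dually [pi_closed] is
    antitone, and the outer meet is attained there. *)
Lemma sigma_ext_closed (f : A -> D) F : down_base F ->
  sigma_ext e f (bigmeet (e @` F)) = sigma_closed e f (bigmeet (e @` F)).
Proof.
move=> bF; apply/le_anti/andP; split.
  apply: (bigjoin_le cD) => _ [k [_ le_kF] <-].
  apply: (le_bigmeet cD) => _ [a le_Fa <-].
  by apply: (bigmeet_le cD); exists a => //=; exact: le_trans le_Fa.
apply: (le_bigjoin cD); exists (bigmeet (e @` F)) => //.
by split=> //; exact: closed_bigmeet.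
Qed.

Lemma pi_ext_closed (f : A -> D) F : down_base F ->
  pi_ext e f (bigmeet (e @` F)) = pi_closed e f (bigmeet (e @` F)).
Proof.
move=> bF; apply/le_anti/andP; split.
  apply: (bigmeet_le cD); exists (bigmeet (e @` F)) => //.
  by split=> //; exact: closed_bigmeet.
apply: (le_bigmeet cD) => _ [k [_ le_kF] <-].
apply: (bigjoin_le cD) => _ [a le_Fa <-].
by apply: (le_bigjoin cD); exists a => //=; exact: le_trans le_Fa.
Qed.

End CanonicalExtension.

(** * Open elements, joins and subtraction, by order duality *)

Section CanonicalExtensionDual.
Context (d d' : Order.disp_t) (A : tbLatticeType d) (D : tbLatticeType d').
Context (e : A -> D).
Hypothesis canD : canonical_extension e.
Implicit Types (F G I J : set A) (a b : A) (u v w : D).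

Let canDd := canonical_extension_dual canD.

Lemma open_le u v :
  (forall I, up_base I -> v <= bigjoin (e @` I) -> u <= bigjoin (e @` I)) ->
  u <= v.
Proof. exact: (@closed_le _ _ A^d D^d e canDd v u). Qed.

Lemma canext_join a b : e (a `|` b) = e a `|` e b.
Proof. exact: (@canext_meet _ _ A^d D^d e canDd a b). Qed.

Lemma canext_compact_join F I J : down_base F -> up_base I -> up_base J ->
  bigmeet (e @` F) <= bigjoin (e @` I) `|` bigjoin (e @` J) ->
  exists a b c, [/\ F a, I b, J c & a <= b `|` c].
Proof.
move=> bF bI bJ le_FIJ.
have [b [c [a [Ib Jc Fa le_abc]]]] :=
  @canext_compact_meet _ _ A^d D^d e canDd I J F bI bJ bF le_FIJ.
by exists a, b, c.
Qed.

Lemma dsub_dual u v : dsub u v = @dimp _ D^d v u.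
Proof.
(* [largest_of] in [D^d] unfolds to [least_of] in [D]; only the order of the arguments of the join
   differs. *)
rewrite /dsub /dimp; congr (least_of _).
by apply/seteqP; split => w /=; rewrite joinC.
Qed.

Lemma le_join_dsub u v : u <= dsub u v `|` v.
Proof. by rewrite joinC dsub_dual; exact: (@meet_dimp_le _ D^d). Qed.

Section Residuation.
Variable sub : A -> A -> A.
Hypothesis subP : forall a b c, (sub a b <= c) = (a <= c `|` b).
Variables F I : set A.
Hypotheses (bF : down_base F) (bI : up_base I).

Definition subs : set A := [set c | exists x y, [/\ F x, I y & c = sub x y]].

(** With its arguments swapped, subtraction is the Heyting implication of [A^d]. *)
Let impd : A^d -> A^d -> A^d := fun y x => sub x y.

Let impdP (a b c : A^d) : (a `&` c <= b) = (c <= impd a b).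
Proof. by apply/esym; rewrite meetC; exact: subP. Qed.

Let subsE : subs = @imps _ A^d impd I F.
Proof.
apply/seteqP; split=> [_ [x [y [Fx Iy ->]]]|_ [y [x [Iy Fx ->]]]].
  by exists y, x.
by exists x, y.
Qed.

Lemma down_base_subs : down_base subs.
Proof. by rewrite subsE; exact: (@up_base_imps _ A^d impd impdP I F). Qed.

Lemma dsubE :
  dsub (bigmeet (e @` F)) (bigjoin (e @` I)) = bigmeet (e @` subs).
Proof.
by rewrite dsub_dual subsE; exact: (@dimpE _ _ A^d D^d e canDd impd impdP I F).
Qed.

Lemma dsub_le w :
  (dsub (bigmeet (e @` F)) (bigjoin (e @` I)) <= w) =
    (bigmeet (e @` F) <= w `|` bigjoin (e @` I)).
Proof.
rewrite dsub_dual joinC.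
exact: (@le_dimp _ _ A^d D^d e canDd impd impdP I F).
Qed.

End Residuation.

End CanonicalExtensionDual.

(** * Directed families cut out by the relations *)

Section Bases.
Context (d : Order.disp_t) (A : tbLatticeType d).
Implicit Types (prec C Dp : A -> A -> Prop).

(** This lemma and the next four make the values of [dia] and [lhd] closed, and those of [bbox],
    [rhd] and [brhd] open. *)
Lemma down_base_prec prec (a : A) :
  subordination_algebra prec -> down_base [set b | prec a b].
Proof.
move=> [_ tt si _ aa _]; split; first by exists \top; apply: si tt; exact: lex1.
by move=> x y ax ay; exists (x `&` y); [exact: aa | rewrite leIl leIr].
Qed.

Lemma up_base_prec prec (a : A) :
  subordination_algebra prec -> up_base [set b | prec b a].
Proof.
move=> [bb _ _ wo _ oo]; split; first by exists \bot; apply: wo bb _; exact: le0x.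
by move=> x y ax ay; exists (x `|` y); [exact: oo | rewrite leUl leUr].
Qed.

Lemma up_base_notCr C (a : A) :
  precontact_algebra C -> up_base [set b | ~ C a b].
Proof.
move=> [_ tb l _ jr _]; split; first by exists \bot; apply: l tb _; exact: lex1.
by move=> x y ax ay; exists (x `|` y); [exact: jr | rewrite leUl leUr].
Qed.

Lemma up_base_notCl C (a : A) :
  precontact_algebra C -> up_base [set b | ~ C b a].
Proof.
move=> [bt _ _ r _ jl]; split; first by exists \bot; apply: r bt _; exact: lex1.
by move=> x y ax ay; exists (x `|` y); [exact: jl | rewrite leUl leUr].
Qed.

Lemma down_base_notD Dp (a : A) :
  dual_precontact_algebra Dp -> down_base [set b | ~ Dp a b].
Proof.
move=> [_ bt l _ mr _]; split; first by exists \top; apply: l bt; exact: le0x.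
by move=> x y ax ay; exists (x `&` y); [exact: mr | rewrite leIl leIr].
Qed.

End Bases.

(** * The correspondences between conditions and inequalities *)

Section Correspondence.
Context (d d' : Order.disp_t) (A : tbLatticeType d) (D : tbLatticeType d').
Context (e : A -> D).
Hypothesis canD : canonical_extension e.
Variables prec C Dp : A -> A -> Prop.

Let cD := canext_complete canD.

Section SubordinationPrecontact.
Hypotheses (subP : subordination_algebra prec) (preP : precontact_algebra C).

Let bprec a := down_base_prec a subP.
Let bcerp a := up_base_prec a subP.
Let bCr a := up_base_notCr a preP.
Let bCl a := up_base_notCl a preP.

Lemma le_rhd a b : (e b <= rhd e C a) <-> ~ C a b.
Proof.
split=> [/(canext_le_bigjoin canD (bCr a))[i Ci lebi]|nCab].
  exact: precontact_r preP _ _ _ Ci lebi.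
exact: le_bigjoin_img.
Qed.

Lemma le_brhd a b : (e b <= brhd e C a) <-> ~ C b a.
Proof.
split=> [/(canext_le_bigjoin canD (bCl a))[i Ci lebi]|nCba].
  exact: precontact_l preP _ _ _ Ci lebi.
exact: le_bigjoin_img.
Qed.

Lemma dia_le a b : (dia e prec a <= e b) <-> prec a b.
Proof.
split=> [/(bigmeet_le_canext canD (bprec a))[f pf lefb]|pab].
  exact: subord_WO subP _ _ _ pf lefb.
exact: bigmeet_img_le.
Qed.

Lemma le_bbox a b : (e b <= bbox e prec a) <-> prec b a.
Proof.
split=> [/(canext_le_bigjoin canD (bcerp a))[i pi lebi]|pba].
  exact: subord_SI subP _ _ _ lebi pi.
exact: le_bigjoin_img.
Qed.

Lemma INC_iff : INC prec C <-> forall a, bbox e prec a <= brhd e C a.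
Proof.
split=> [inc a|le_bb a b pab].
  by apply: bigjoin_img_le => // b pba; apply/le_brhd; exact: inc.
by apply/le_brhd; apply: le_trans (le_bb b); exact/le_bbox.
Qed.

Lemma CT_rhd_iff :
  CT_rhd prec C <->
  forall a, rhd_ext e C (e a `&` dia e prec a) <= rhd e C a.
Proof.
(* The argument is closed, as a meet of two closed elements, so the extension reduces to its formula
   on closed elements. *)
have rhd_extE a : rhd_ext e C (e a `&` dia e prec a) =
    pi_closed e (rhd e C) (e a `&` dia e prec a).
  have b1 := down_base1 a.
  rewrite /rhd_ext -(bigmeet_img1 e a) -(bigmeet_meets canD b1 (bprec a)).
  exact/pi_ext_closed/down_base_meets.
split=> [ct a|le_rr a b c pab nCabc].
  rewrite rhd_extE; apply: (bigjoin_le cD) => _ [b /= le_ab <-].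
  apply: bigjoin_img_le => // c /= nCbc; apply/le_rhd.
  move: le_ab; rewrite -(bigmeet_img1 e a) -(bigjoin_img1 e b) => le_ab.
  have [_ [x [_ [-> pax -> le_axb]]]] :=
    canext_compact_meet canD (down_base1 a) (bprec a) (up_base1 b) le_ab.
  by apply: ct pax _; exact: precontact_l preP _ _ _ nCbc le_axb.
(* The meet of [a] and [b] is one of the indices of the join, because [prec a b] puts [dia e prec a]
   below [e b]. *)
apply/le_rhd; apply: le_trans (le_rr a); rewrite rhd_extE.
have le_c : e c <= rhd e C (a `&` b) by exact/le_rhd.
apply: (le_trans le_c); apply: (le_bigjoin cD); exists (a `&` b) => //=.
by rewrite (canext_meet canD) leI2//; exact/dia_le.
Qed.

Lemma CS2_iff (imp : A -> A -> A) : heyting_algebra imp ->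
  CS2 prec C <->
  forall a, dimp (dia e prec a) (rhd e C a) <= rhd e C a.
Proof.
move=> [_ impP]; split=> [cs a|le_dr a x y nCaxy pax].
  apply: (closed_le canD) => F bF le_F.
  have le_dF : dia e prec a `&` bigmeet (e @` F) <= rhd e C a.
    by apply: le_trans (meet_dimp_le _ _); exact: leI2.
  have [x [f [y [pax Ff nCay le_xfy]]]] :=
    canext_compact_meet canD (bprec a) bF (bCr a) le_dF.
  apply: le_trans (bigmeet_img_le canD Ff) _; apply/le_rhd.
  by apply: cs pax; exact: precontact_r preP _ _ _ nCay le_xfy.
(* It remains to put [e y] below the implication; by residuation this follows from
   [dia e prec a <= e x]. *)
apply/le_rhd; apply: le_trans (le_dr a).
rewrite (le_dimp canD impP (bprec a) (bCr a)).
have le_xy : e (x `&` y) <= rhd e C a by exact/le_rhd.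
apply: le_trans le_xy; rewrite (canext_meet canD) leI2//; exact/dia_le.
Qed.

Lemma CT_down_iff (imp : A -> A -> A) : heyting_algebra imp ->
  CT_down prec C <->
  forall b c, bbox e prec b `&` brhd e C (b `&` c) <= dimp (e b) (brhd e C c).
Proof.
move=> [_ impP].
have le_dimpE b c w :
    (w <= dimp (e b) (brhd e C c)) = (e b `&` w <= brhd e C c).
  by rewrite -(bigmeet_img1 e b); exact: (le_dimp canD impP (down_base1 b) (bCl c)).
split=> [ct b c|le_d a b c pab nCabc].
  rewrite le_dimpE; apply: (closed_le canD) => F bF.
  rewrite !lexI => /and3P[le_Fb].
  move=> /(canext_compact_base canD bF (bcerp b))[f [x [Ff pxb le_fx]]].
  move=> /(canext_compact_base canD bF (bCl _))[g [y [Fg nCy le_gy]]].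
  have [_ dF] := bF; have [h Fh [le_hf le_hg]] := dF _ _ Ff Fg.
  (* The condition, applied to [h], only controls the meet of [h] and [b]; this suffices because the
     closed element also lies below [e b]. *)
  apply: (@le_trans _ _ (e (h `&` b))).
    by rewrite (canext_meet canD) lexI le_Fb bigmeet_img_le.
  apply/le_brhd; apply: ct.
    exact: subord_SI subP _ _ _ (le_trans le_hf le_fx) pxb.
  exact: precontact_l preP _ _ _ nCy (le_trans le_hg le_gy).
apply/le_brhd; rewrite meetC (canext_meet canD) -le_dimpE.
apply: le_trans (le_d b c); rewrite lexI; apply/andP; split.
  exact/le_bbox.
exact/le_brhd.
Qed.

Lemma CS1_iff (sub : A -> A -> A) : coheyting_algebra sub ->
  CS1 prec C <->
  forall a, dia e prec a <= dsub (dia e prec a) (rhd e C a).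
Proof.
move=> [_ subrP]; split=> [cs a|le_d a x y paxy nCax].
  (* The subtraction is on the right, so the test runs over the open elements above it. Compactness
     then gives [z] below the join of [i] and [x], and the condition cancels [x]. *)
  apply: (open_le canD) => I bI le_I.
  have le_dI : dia e prec a <= bigjoin (e @` I) `|` rhd e C a.
    exact: le_trans (le_join_dsub _ _) (leU2 le_I (lexx _)).
  have [z [i [x [paz Ii nCax le_z]]]] :=
    canext_compact_join canD (bprec a) bI (bCr a) le_dI.
  apply: le_trans (le_bigjoin_img canD Ii); apply/dia_le; apply: cs nCax.
  by rewrite joinC; exact: subord_WO subP _ _ _ paz le_z.
apply/dia_le; apply: le_trans (le_d a) _.
rewrite (dsub_le canD subrP (bprec a) (bCr a)).
have le_xy : dia e prec a <= e (x `|` y) by exact/dia_le.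
apply: le_trans le_xy _; rewrite (canext_join canD) joinC.
by apply: leU2 => //; exact/le_rhd.
Qed.

End SubordinationPrecontact.

Section SubordinationDualPrecontact.
Hypotheses (subP : subordination_algebra prec).
Hypotheses (dpreP : dual_precontact_algebra Dp).

Let bD a := down_base_notD a dpreP.

Lemma lhd_le a b : (lhd e Dp a <= e b) <-> ~ Dp a b.
Proof.
split=> [/(bigmeet_le_canext canD (bD a))[f Df lefb]|nDab].
  exact: dprecontact_r dpreP _ _ _ Df lefb.
exact: bigmeet_img_le.
Qed.

Lemma CT_lhd_iff (sub : A -> A -> A) : coheyting_algebra sub ->
  CT_lhd prec Dp sub <->
  forall a, lhd e Dp a <= dia_ext e prec (dsub (lhd e Dp a) (e a)).
Proof.
move=> [_ subrP].
(* With [e a] viewed as open, the subtraction is the meet of the down-directed family [S a]; it is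
   thus closed, and [sigma_ext] reduces to [sigma_closed]. *)
pose S a := subs sub [set b | ~ Dp a b] [set a].
have bS a : down_base (S a) := down_base_subs subrP (bD a) (up_base1 a).
have dsubE' a : dsub (lhd e Dp a) (e a) = bigmeet (e @` S a).
  by rewrite -(bigjoin_img1 e a); exact: (dsubE canD subrP (bD a) (up_base1 a)).
have dia_extE a : dia_ext e prec (dsub (lhd e Dp a) (e a)) =
    sigma_closed e (dia e prec) (bigmeet (e @` S a)).
  by rewrite dsubE'; exact: (sigma_ext_closed canD).
split=> [ct a|le_ld a b c nDab pbac].
  rewrite dia_extE; apply: (le_bigmeet cD) => _ [x le_Sx <-].
  apply: (le_bigmeet_img canD) => c pxc; apply/lhd_le.
  (* Compactness yields [b] with [~ Dp a b] and [sub b a <= x], so that [prec x c] gives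
     [prec (sub b a) c]. *)
  have [_ [b [_ [nDab -> ->]]] le_bax] := bigmeet_le_canext canD (bS a) le_Sx.
  by apply: (ct a b c nDab); exact: subord_SI subP _ _ _ le_bax pxc.
apply/lhd_le; apply: le_trans (le_ld a) _; rewrite dia_extE.
have le_c : dia e prec (sub b a) <= e c by exact/dia_le.
apply: le_trans le_c; apply: (bigmeet_le cD); exists (sub b a) => //=.
by apply: (bigmeet_img_le canD); exists b, a.
Qed.

End SubordinationDualPrecontact.

End Correspondence.

Theorem proposition5p6 (d d' : Order.disp_t)
    (A : tbLatticeType d) (D : tbLatticeType d') (e : A -> D)
    (canD : canonical_extension e)
    (prec C Dp : A -> A -> Prop)
    (spH : sp_algebra prec C) (sdpK : sdp_algebra prec Dp) :
  (INC prec C <-> forall a : A, bbox e prec a <= brhd e C a) /\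
  (CT_rhd prec C <->
     forall a : A,
       rhd_ext e C (e a `&` dia e prec a) <= rhd e C a) /\
  (forall imp : A -> A -> A, heyting_algebra imp ->
     (CS2 prec C <->
        forall a : A,
          dimp (dia e prec a) (rhd e C a) <= rhd e C a) /\
     (CT_down prec C <->
        forall b c : A,
          bbox e prec b `&` brhd e C (b `&` c) <= dimp (e b) (brhd e C c))) /\
  (forall sub : A -> A -> A, coheyting_algebra sub ->
     (CS1 prec C <->
        forall a : A,
          dia e prec a
            <= dsub (dia e prec a) (rhd e C a))) /\
  (forall sub : A -> A -> A, coheyting_algebra sub ->
     (CT_lhd prec Dp sub <->
        forall a : A,
          lhd e Dp a <= dia_ext e prec (dsub (lhd e Dp a) (e a)))).
Proof.
have [[subP preP] [_ dpreP]] := (spH, sdpK).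
split; first exact: INC_iff.
split; first exact: CT_rhd_iff.
split; first by move=> imp impP; split; [exact: CS2_iff impP | exact: CT_down_iff impP].
by split=> sub subrP; [exact: CS1_iff subrP | exact: CT_lhd_iff subrP].
Qed.
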